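(* Let $\sigma$ be a Sturmian subshift preserving an invariant Borel probability measure $\mu$. Then there is a family of scales $\{a_\chi\}$ such that $$0=h_{\mu,a_\chi}(\sigma)<h_{\mathrm{top},a_\chi}(\sigma).$$
   Context: A Sturmian subshift is the closed two-symbol subshift generated by a Sturmian sequence (the natural symbolic coding of an irrational circle rotation); it is a zero-entropy, uniquely ergodic subshift, and its unique invariant measure makes it measurably isomorphic to an irrational circle rotation. Here $\sigma$ denotes the shift homeomorphism on the (two-sided) subshift. A family of scales is a family of functions $a_\chi:\mathbb R_+\to\mathbb R_+$, $\chi\in\mathbb R_+$, with $a_\chi(T)\to\infty$ as $T\to\infty$ and $a_\chi=o(a_{\chi'})$ whenever $\chi<\chi'$. Topological slow entropy of a homeomorphism $f$ of a compact metric space $X$: let $B_f^T(x,\epsilon)=\bigcap_{0\le t\le T}f^{-t}(B(f^t(x),\epsilon))$ ($t$ integer), let $N_{f,X}(\epsilon,T)$ be the minimal number of sets $B_f^T(x,\epsilon)$ needed to cover $X$, and $h_{\mathrm{top},a_\chi}(f)=\lim_{\epsilon\to0}\sup\{\chi:\limsup_{T\to\infty}N_{f,X}(\epsilon,T)/a_\chi(T)>0\}$ (with $\sup\emptyset=0$). Metric slow entropy for an $f$-invariant probability measure $\mu$: for a finite measurable partition $\mathcal P=\{P_1,\dots,P_k\}$ write $x_s=i$ if $f^s(x)\in P_i$, let $\bar d_{f,\mathcal P}^T(x,y)=\frac1T\#\{0\le s<T:x_s\ne y_s\}$, let $S(\mathcal P,T,\epsilon)$ be the minimal number of $\bar d_{f,\mathcal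 P}^T$-balls of radius $\epsilon$ whose union has $\mu$-measure $>1-\epsilon$, and $h_{\mu,a_\chi}(f)=\sup_{\mathcal P}\lim_{\epsilon\to0}\sup\{\chi:\limsup_{T\to\infty}S(\mathcal P,T,\epsilon)/a_\chi(T)>0\}$ (with $\sup\emptyset=0$). *)

(* Defs.v *)
From HB Require Import structures.
From mathcomp Require Import all_boot all_order all_algebra.
From mathcomp Require Import all_classical all_reals all_analysis.
Set Implicit Arguments.
Unset Strict Implicit.
Unset Printing Implicit Defensive.
Import Order.TTheory GRing.Theory Num.Theory.
Import numFieldNormedType.Exports.

Local Open Scope classical_set_scope.
Local Open Scope ring_scope.

Section SlowEntropy.
Context {R : realType}.
Implicit Types (a : R -> R -> R).

(* [a chi T] is a_chi(T); R_+ is read as the open half-line, so values of [a]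
   at nonpositive arguments are irrelevant.  As the scales are positive, the
   last clause is a_chi = o(a_chi'). *)
Definition scale_family a : Prop :=
  [/\ forall chi t, 0 < chi -> 0 < t -> 0 < a chi t,
      forall chi, 0 < chi -> a chi t @[t --> +oo] --> +oo &
      forall chi chi', 0 < chi -> chi < chi' ->
        a chi t / a chi' t @[t --> +oo] --> 0].

(* sup {chi | limsup_T u(T) / a_chi(T) > 0}; adjoining 0 to a set of positive
   reals only implements the convention sup set0 = 0. *)
Definition growth_exponent a (u : nat -> \bar R) : \bar R :=
  ereal_sup ([set 0%E] `|`
    [set chi%:E | chi in [set chi | 0 < chi /\
      (0 < limn_esup (fun T => u T * ((a chi T%:R)^-1)%:E))%E]]).

Section Topological.
Context {X : metricType R}.
Variable f : X -> X.

Definition bowen_ball (T : nat) (x : X) (eps : R) : set X :=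
  \bigcap_(t in [set t | (t <= T)%N])
    (iter t f @^-1` ball (iter t f x) eps).

(* The infimum is +oo when no finite cover exists. *)
Definition bowen_covering_number (eps : R) (T : nat) : \bar R :=
  ereal_inf [set (n%:R)%:E | n in [set n | exists c : 'I_n -> X,
    \bigcup_i bowen_ball T (c i) eps = [set: X]]].

Definition topological_slow_entropy a : \bar R :=
  lim (growth_exponent a (bowen_covering_number eps) @[eps --> 0^'+]).

End Topological.

Section Metric.
Context {d : measure_display} {X : measurableType d}.
Variables (mu : probability X R) (f : X -> X).

Definition measure_preserving : Prop :=
  forall A : set X, measurable A -> mu (f @^-1` A) = mu A.

Definition measurable_partition (k : nat) (P : 'I_k -> set X) : Prop :=
  [/\ forall i, measurable (P i), trivIset setT P & \bigcup_i P i = [set: X]].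

(* The symbol x_s; it is never [None] when [P] is a partition. *)
Definition symbol_at (k : nat) (P : 'I_k -> set X) (s : nat) (x : X) :
  option 'I_k := [pick i | iter s f x \in P i].

Definition hamming_dist (k : nat) (P : 'I_k -> set X) (T : nat) (x y : X) : R :=
  #|[pred s : 'I_T | symbol_at P s x != symbol_at P s y]|%:R / T%:R.

Definition hamming_covering_number (k : nat) (P : 'I_k -> set X)
    (eps : R) (T : nat) : \bar R :=
  ereal_inf [set (n%:R)%:E | n in [set n | exists c : 'I_n -> X,
    ((1 - eps)%:E <
      mu (\bigcup_i [set y | (hamming_dist P T (c i) y < eps)%R]))%E]].

Definition metric_slow_entropy a : \bar R :=
  ereal_sup [set h | exists k (P : 'I_k -> set X), measurable_partition P /\
    h = lim (growth_exponent a (hamming_covering_number P eps)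
               @[eps --> 0^'+])].

End Metric.
End SlowEntropy.

Definition biseq : Type := int -> bool.

HB.instance Definition _ := Choice.copy biseq (prod_topology (fun _ : int => bool)).
HB.instance Definition _ :=
  Uniform.copy biseq (prod_topology (fun _ : int => bool)).

Definition shift_by (k : int) (x : biseq) : biseq := fun n => x (n + k).

Definition shift : biseq -> biseq := shift_by 1.

Definition agree (m : nat) (x y : biseq) : Prop :=
  forall n : int, (`|n| < m)%N -> x n = y n.

(* 2^-m, where m is the least |n| with x n <> y n, and 0 when x = y *)
Definition biseq_dist {R : realType} (x y : biseq) : R :=
  inf [set 2^-1 ^+ m | m in [set m | agree m x y]].

Section BiseqMetric.
Context {R : realType}.
Implicit Types x y z : biseq.

Lemma half_expr_gt0 m : 0 < 2^-1 ^+ m :> R.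
Proof. by rewrite exprn_gt0. Qed.

Lemma half_expr_lt (e : R) : 0 < e -> exists m, 2^-1 ^+ m < e.
Proof.
move=> e0.
have : (2^-1 ^+ n : R) @[n --> \oo] --> (0 : R).
  by apply: cvg_expr; rewrite ger0_norm ?invr_ge0// invf_lt1 ?ltr1n.
move/cvgrPdist_lt => /(_ e e0) [N _ /(_ N (leqnn N))] /=.
by rewrite sub0r normrN ger0_norm ?ltW ?half_expr_gt0//; exists N.
Qed.

Let dset x y : set R := [set 2^-1 ^+ m | m in [set m | agree m x y]].

Let has_inf_dset x y : has_inf (dset x y).
Proof.
split; first by exists 1, 0%N => //= n.
by exists 0 => _ [m _ <-]; rewrite ltW ?half_expr_gt0.
Qed.

Lemma biseq_dist_ltP x y (e : R) :
  biseq_dist x y < e <-> exists2 m, agree m x y & 2^-1 ^+ m < e.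
Proof.
split=> [/inf_lt|[m xy]].
  by case/(_ (proj1 (has_inf_dset x y))) => _ [m xy <-] ?; exists m.
by apply: le_lt_trans; apply: ge_inf; [case: (has_inf_dset x y)|exists m].
Qed.

Lemma biseq_dist_ge0 x y : 0 <= biseq_dist x y :> R.
Proof.
apply: lb_le_inf; first by case: (has_inf_dset x y).
by move=> _ [m _ <-]; rewrite ltW ?half_expr_gt0.
Qed.

Lemma biseq_dist_eq0 x y : biseq_dist x y = 0 :> R -> x = y.
Proof.
move=> xy0; apply/funext => n.
have /biseq_dist_ltP [m xy] : biseq_dist x y < 2^-1 ^+ `|n|%N :> R.
  by rewrite xy0 half_expr_gt0.
rewrite ltr_iXn2l ?invr_gt0 ?invf_lt1 ?ltr1n// => nm.
exact: xy.
Qed.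

Let dball x (e : R) : set biseq := [set y | biseq_dist x y < e].

Let dball_center x (e : R) : 0 < e -> dball x e x.
Proof.
by move=> /half_expr_lt[m me]; apply/biseq_dist_ltP; exists m.
Qed.

Let dball_sym x y (e : R) : dball x e y -> dball y e x.
Proof.
move=> /biseq_dist_ltP[m xy me]; apply/biseq_dist_ltP.
by exists m => // n nm; rewrite xy.
Qed.

Let dball_triangle x y z (e1 e2 : R) :
  dball x e1 y -> dball y e2 z -> dball x (e1 + e2) z.
Proof.
move=> /biseq_dist_ltP[m xy me] /biseq_dist_ltP[p yz pe].
apply/biseq_dist_ltP; exists (minn m p).
  by move=> n; rewrite leq_min => /andP[nm np]; rewrite xy ?yz.
have [mp|pm] := leqP m p.
  by rewrite (lt_le_trans me)// lerDl ltW// (le_lt_trans _ pe)// ltW ?half_expr_gt0.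
by rewrite (lt_le_trans pe)// lerDr ltW// (le_lt_trans _ me)// ltW ?half_expr_gt0.
Qed.

Let coord_entourage (n : int) :
  entourage [set xy : biseq * biseq | xy.1 n = xy.2 n].
Proof.
pose V : set (biseq * biseq) := [set xy | xy.1 n = xy.2 n].
have entV : @initial_ent biseq bool (fun x => x n) V.
  by exists diagonal => //; rewrite uniform_discrete => _ [b _ <-].
rewrite /entourage/= /sup_ent smallest_filter_finI.
move=> F [FF]; apply.
unshelve eexists (exist _ (n : {classic int}, V) _) => //; exact/asboolP.
Qed.

Let agree_entourage m :
  entourage [set xy : biseq * biseq | agree m xy.1 xy.2].
Proof.
elim: m => [|m IHm]; first by apply: filterS entourageT => xy _ n.
apply: filterS (filterI IHm (filterI (coord_entourage m%:Z)
  (coord_entourage (- m%:Z)))) => xy [/= xym [xyp xyn]] n.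
rewrite ltnS leq_eqVlt => /orP[/eqP nm|/xym//].
by case: (intP n) nm => [|k|k] nm; rewrite -nm in xyp xyn; rewrite ?absz_nat ?abszN ?absz_nat in xyp xyn.
Qed.

Let dball_entourage : entourage = entourage_ dball.
Proof.
apply/seteqP; split=> A.
  rewrite {1}/entourage/= /sup_ent smallest_filter_finI; apply.
  split.
    apply: filter_from_filter; first by exists 1 => /=.
    move=> e1 e2 e10 e20; exists (Order.min e1 e2).
      by rewrite /= lt_min e10 e20.
    by move=> xy /=; rewrite /dball /= lt_min => /andP[].
  move=> _ [[[n V] /= /asboolP [W entW WV]] _ <-] /=.
  exists (2^-1 ^+ `|n|%N); first exact: half_expr_gt0.
  move=> xy /= /biseq_dist_ltP[m xym].
  rewrite ltr_iXn2l ?invr_gt0 ?invf_lt1 ?ltr1n// => nm; apply: WV => /=.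
  move: entW; rewrite uniform_discrete; apply.
  exists (xy.1 n) => //.
  by congr pair; exact: xym.
move=> [e /half_expr_lt[m me] eA].
apply: filterS (agree_entourage m) => xy xym; apply: eA.
by apply/biseq_dist_ltP; exists m.
Qed.

HB.instance Definition _ := Uniform_isPseudoMetric.Build R biseq
  dball_center dball_sym dball_triangle dball_entourage.

HB.instance Definition _ := PseudoMetric_isMetric.Build R biseq
  biseq_dist_ge0 biseq_dist_eq0 (fun _ _ => erefl).

End BiseqMetric.

Definition orbit_closure (s : biseq) : set biseq :=
  closure [set shift_by k s | k in [set: int]].

Lemma shift_continuous : continuous shift.
Proof.
move=> x; apply/cvg_sup => n U [_ [[W oW <-] /= Wx WU]].
apply: (filterS WU); rewrite /nbhs/=.
apply: (@proj_continuous _ (fun _ : int => bool) (n + 1) x).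
exact: open_nbhs_nbhs.
Qed.

Lemma shift_orbit_closure (s x : biseq) :
  orbit_closure s x -> orbit_closure s (shift x).
Proof.
move=> sx B /shift_continuous/sx [_ [[k _ <-] Bk]].
exists (shift (shift_by k s)); split => //; exists (k + 1) => //.
by apply/funext => n; rewrite /shift /shift_by -addrA (addrC k).
Qed.

Definition subshift (s : biseq) : Type := set_type (orbit_closure s).

Section SubshiftStructures.
Variable s : biseq.

HB.instance Definition _ := Uniform.copy (subshift s) (set_type (orbit_closure s)).

Lemma mem_orbit_closure : s \in orbit_closure s.
Proof.
apply/mem_set/subset_closure; exists 0 => //.
by apply/funext => n; rewrite /shift_by addr0.
Qed.

HB.instance Definition _ := isPointed.Build (subshift s) (exist _ s mem_orbit_closure).

HB.instance Definition _ {R : realType} :=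
  PseudoMetric.copy (subshift s) (set_type (orbit_closure s) : pseudoMetricType R).

Definition subshift_map (x : subshift s) : subshift s :=
  exist _ (shift (val x)) (mem_set (shift_orbit_closure (set_valP x))).

End SubshiftStructures.

Section SubshiftMetric.
Context {R : realType} (s : biseq).
Implicit Types x y : subshift s.

Let sub_dist x y : R := biseq_dist (val x) (val y).

Let sub_dist_ge0 x y : 0 <= sub_dist x y.
Proof. exact: biseq_dist_ge0. Qed.

Let sub_dist_eq0 x y : sub_dist x y = 0 -> x = y.
Proof. by move/biseq_dist_eq0/val_inj. Qed.

HB.instance Definition _ := PseudoMetric_isMetric.Build R (subshift s)
  sub_dist_ge0 sub_dist_eq0 (fun _ _ => erefl).

End SubshiftMetric.

Definition fractional_part {R : realType} (x : R) : R := x - (Num.floor x)%:~R.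

(* Codings of the orbit of rho under the rotation by alpha with respect to the
   two half-open versions of the partition of the circle R/Z into an arc of
   length 1 - alpha and an arc of length alpha: [1 - alpha, 1) and
   (1 - alpha, 1], the point 1 being identified with 0. *)
Definition sturmian_sequence {R : realType} (s : biseq) : Prop :=
  exists alpha rho : R, [/\ 0 < alpha < 1, irrational alpha &
    (forall n : int, s n = (1 - alpha <= fractional_part (rho + n%:~R * alpha)))
    \/ (forall n : int,
          let t := fractional_part (rho + n%:~R * alpha) in
          s n = (1 - alpha < t) || (t == 0))].

(* Main.v *)
(* A Sturmian sequence is not periodic, so the number g(n) of its words of
   length n tends to infinity; since Bowen balls of radius at most 1 separate
   words, the scales a_chi(T) = g(T)^chi give topological slow entropy at
   least 1.
   The Hamming covering numbers of every partition are bounded in T, so the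
   metric slow entropy vanishes for every family of scales: up to a set E of
   small measure the atoms depend on finitely many coordinates, and most points
   rarely visit E by Markov's inequality.  The coordinates are controlled by the
   rotation: if the angles of two orbit points are close, then their symbols
   differ only when the rotation visits a short arc around an endpoint, and such
   visits are separated by at least J steps, where J grows as the arc shrinks. *)
Require Import Defs.
From mathcomp Require Import all_boot all_order all_algebra.
From mathcomp Require Import all_classical all_reals all_analysis.
From mathcomp Require Import measurable_realfun zify lra.
Set Implicit Arguments.
Unset Strict Implicit.
Unset Printing Implicit Defensive.
Import Order.TTheory GRing.Theory Num.Theory.
Import numFieldNormedType.Exports.
Local Open Scope classical_set_scope.
Local Open Scope ring_scope.

(** * Rotation *)

(** Elements of [P] are at least [J] apart, so division by [J] is injective on [P], with values at
    most [T %/ J]. *)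
Lemma card_separated (T J : nat) (P : pred 'I_T) : (0 < J)%N ->
  (forall i j : 'I_T, P i -> P j -> (i < j)%N -> (J <= j - i)%N) ->
  (#|P| <= (T %/ J).+1)%N.
Proof.
move=> J0 sep.
pose f (i : 'I_T) : 'I_(T %/ J).+1 := inord (i %/ J)%N.
have fE i : f i = (i %/ J)%N :> nat.
  by rewrite inordK// ltnS leq_div2r// ltnW.
have finj : {in P &, injective f}.
  have key (i j : 'I_T) : P i -> P j -> (i < j)%N -> f i <> f j.
    move=> Pi Pj ij /(congr1 val)/=; rewrite !fE => e.
    have := sep _ _ Pi Pj ij.
    have := divn_eq i J; have := divn_eq j J.
    have := ltn_pmod i J0; have := ltn_pmod j J0.
    rewrite e; lia.
  move=> i j Pi Pj ij; apply/val_inj; case: (ltngtP i j) => //.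
    by move=> /(key _ _ Pi Pj)/(_ ij).
  by move=> /(key _ _ Pj Pi)/(_ (esym ij)).
rewrite -(card_in_image finj) (leq_trans (max_card _))// card_ord//.
Qed.

Section Rotation.
Context {R : realType}.
Implicit Types (t alpha delta : R) (F : R -> int).

(* Common features of floor and ceiling, which produce the two codings. *)
Definition integer_rounding F : Prop :=
  [/\ forall t (q : int), F (t + q%:~R) = F t + q,
      forall t, `|(F t)%:~R - t| <= 1 &
      forall t t', t <= t' -> F t != F t' -> exists p : int, t <= p%:~R <= t'].

Lemma integer_rounding_floor : integer_rounding (@Num.floor R).
Proof.
split=> [t q|t|t t' tt' ftt'].
- by rewrite floorDrz ?intrKfloor ?intr_int.
- by have := floor_le t; have := floorD1_gt t; rewrite ler_norml rmorphD/=; lra.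
- exists (Num.floor t'); rewrite floor_le andbT.
  have : (Num.floor t + 1 <= Num.floor t')%R.
    by rewrite lezD1 lt_neqAle ftt' le_floor.
  rewrite -(ler_int R) => le1.
  by have := floorD1_gt t; lra.
Qed.

Lemma integer_rounding_ceil : integer_rounding (@Num.ceil R).
Proof.
case: integer_rounding_floor => A B C.
split=> [t q|t|t t' tt'].
- by rewrite !ceilNfloor opprD -mulrNz A opprD opprK.
- by rewrite ceilNfloor mulrNz -normrN opprD !opprK; have := B (- t); rewrite opprK.
- rewrite !ceilNfloor eqr_opp eq_sym => ne.
  have [p /andP[p1 p2]] : exists p : int, - t' <= p%:~R <= - t.
    by apply: C => //; lra.
  by exists (- p); rewrite mulrNz; apply/andP; split; lra.
Qed.

(** As 0 < alpha < 1, one step of the rotation passes at most one integer, and the symbol 1 records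
    that it does. The floor produces the coding by [1 - alpha, 1), the ceiling the one by (1 -
    alpha, 1]. *)
Lemma sturmian_rounding (s : biseq) : sturmian_sequence (R := R) s ->
  exists alpha rho F, [/\ irrational alpha, integer_rounding F &
    forall n : int, (s n : nat)%:Z =
      F (rho + (n + 1)%:~R * alpha) - F (rho + n%:~R * alpha)].
Proof.
move=> [alpha [rho [/andP[a0 a1] irr]]].
have tE n : rho + (n + 1)%:~R * alpha = rho + n%:~R * alpha + alpha.
  by rewrite rmorphD/= mulrDl mul1r addrA.
case=> sE.
  exists alpha, rho, Num.floor; split => //.
    exact: integer_rounding_floor.
  move=> n; rewrite sE tE /fractional_part; set t := rho + _.
  have := floor_le t; have := floorD1_gt t; rewrite rmorphD/= => u1 u2.
  have [h|h] := leP; last first.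
    rewrite (@floor_def _ (t + alpha) (Num.floor t)) ?subrr// rmorphD/=.
    apply/andP; split; lra.
  rewrite (@floor_def _ (t + alpha) (Num.floor t + 1)) ?(addrC _ 1) ?addrK//.
  rewrite !rmorphD/=; apply/andP; split; lra.
exists alpha, rho, Num.ceil; split => //.
  exact: integer_rounding_ceil.
move=> n; rewrite sE tE /fractional_part; set t := rho + _.
have := floor_le t; have := floorD1_gt t; rewrite rmorphD/= => u1 u2.
have [h|h] /= := ltP (1 - alpha) (t - (Num.floor t)%:~R).
  have -> : Num.ceil t = Num.floor t + 1.
    by apply/ceil_def; rewrite !rmorphD/= addrK; apply/andP; split; lra.
  have -> : Num.ceil (t + alpha) = Num.floor t + 2.
    by apply/ceil_def; rewrite !rmorphD/=; apply/andP; split; lra.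
  by rewrite opprD addrACA subrr.
have ceilta : Num.ceil (t + alpha) = Num.floor t + 1.
  by apply/ceil_def; rewrite !rmorphD/=; apply/andP; split; lra.
have [h'|h'] := eqVneq; last first.
  have -> : Num.ceil t = Num.floor t + 1.
    apply/ceil_def; rewrite !rmorphD/= addrK; apply/andP; split; last by lra.
    have : t - (Num.floor t)%:~R > 0 by rewrite lt_neqAle eq_sym h'/=; lra.
    lra.
  by rewrite ceilta subrr.
have -> : Num.ceil t = Num.floor t.
  by apply/ceil_def; rewrite !rmorphD/=; apply/andP; split; lra.
by rewrite ceilta addrC addKr.
Qed.

Lemma irrational_mul alpha (j : nat) (p : int) : irrational alpha ->
  (0 < j)%N -> j%:R * alpha <> p%:~R.
Proof.
move=> irr j0 e; apply: irr.
exists (p%:Q / j%:Q) => //; rewrite fmorph_div/= !ratr_int.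
by rewrite -e -pmulrn mulrAC mulfV ?mul1r// pnatr_eq0 -lt0n.
Qed.

(** Under a period p, the roundings along multiples of p grow linearly with an integer slope c. They
    stay within 1 of the angles, whose slope is p * alpha, so p * alpha = c, against
    irrationality. *)
Lemma sturmian_aperiodic (s : biseq) (p : nat) :
  sturmian_sequence (R := R) s -> (0 < p)%N -> ~ (forall n, s (n + p%:Z) = s n).
Proof.
move=> /sturmian_rounding [alpha [rho [F [irr [_ Fb _] sE]]]] p0 per.
pose u (n : nat) := F (rho + n%:R * alpha).
have uS n : u n.+1 = u n + (s n%:Z : nat)%:Z.
  by rewrite sE addrC subrK /u -natr1 rmorphD.
have uD n : u (n + p)%N = u n + (u p - u 0%N).
  elim: n => [|n IH]; first by rewrite add0n addrC subrK.
  by rewrite addSn !uS IH PoszD per addrAC.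
have uM m : u (m * p)%N = u 0%N + (u p - u 0%N) *+ m.
  elim: m => [|m IH]; first by rewrite mul0n mulr0n addr0.
  by rewrite mulSn addnC uD IH mulrS -addrA (addrC (u p - _)).
set c := u p - u 0%N in uM.
pose e := `|p%:R * alpha - c%:~R|.
have e0 : 0 < e.
  by rewrite normr_gt0 subr_eq0; apply/eqP; exact: irrational_mul.
(* The roundings at times 0 and m * p each err by at most 1. *)
have bound m : m%:R * e <= 2.
  rewrite /e -[X in X * _]ger0_norm// -normrM.
  have := Fb (rho + (m * p)%:R * alpha); rewrite -/(u _) uM.
  have := Fb rho; have <- : u 0%N = F rho by rewrite /u mul0r addr0.
  rewrite !ler_norml rmorphD/= rmorphMn/= natrM -(mulr_natl c%:~R m) mulrBr.
  rewrite -(mulrA m%:R p%:R).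
  move: (m%:R * c%:~R) (m%:R * (p%:R * alpha)) ((u 0%N)%:~R : R) => x y z.
  lra.
have := bound (Num.truncn (2 / e)).+1.
have := truncnS_gt (2 / e).
rewrite ltr_pdivrMr// => h1 h2.
lra.
Qed.

Lemma irrational_multiples_away alpha (J : nat) : irrational alpha ->
  exists2 delta, 0 < delta & forall (j : nat) (p : int), (0 < j < J)%N ->
    delta < `|j%:R * alpha - p%:~R|.
Proof.
move=> irr; elim: J => [|J [d d0 IH]].
  by exists 1 => // j p; rewrite ltn0 andbF.
case: J IH => [|J] IH.
  by exists 1 => // -[|j] p.
pose t := J.+1%:R * alpha; pose f := t - (Num.floor t)%:~R.
have f0 : 0 < f.
  rewrite lt_neqAle subr_ge0 floor_le andbT eq_sym subr_eq0.
  by apply/eqP; exact: irrational_mul.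
have f1 : f < 1 by have := floorD1_gt t; rewrite rmorphD/= /f; lra.
(* [Num.min f (1 - f)] is the distance from [t] to the integers; halving it makes the inequality
   strict. *)
exists (Num.min d (Num.min f (1 - f) / 2)).
  by rewrite !lt_min d0 divr_gt0// lt_min f0; lra.
move=> j p /andP[j0]; rewrite ltnS leq_eqVlt => /orP[/eqP ->|jJ]; last first.
  by rewrite gt_min IH// j0.
rewrite gt_min; apply/orP; right; rewrite -/t.
rewrite ltr_pdivrMr//.
have [h|h] := leP p (Num.floor t).
  have {}h : (p%:~R : R) <= (Num.floor t)%:~R by rewrite ler_int.
  rewrite gt_min; apply/orP; left.
  by rewrite ger0_norm; move: f0; rewrite /f; lra.
have {}h : (Num.floor t)%:~R + 1 <= (p%:~R : R).
  by rewrite -[1]/(1%:~R) -intrD ler_int lezD1.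
rewrite gt_min; apply/orP; right.
by rewrite distrC ger0_norm; move: f1; rewrite /f; lra.
Qed.

(* Two visits of the rotation to a short arc around 0 are at least J apart. *)
Lemma card_near_integer alpha (J : nat) : (0 < J)%N -> irrational alpha ->
  exists2 delta, 0 < delta & forall t (T : nat),
    (#|[pred n : 'I_T |
      `[< exists p : int, (`|t + n%:R * alpha - p%:~R| <= delta)%R >]]|
      <= (T %/ J).+1)%N.
Proof.
move=> J0 irr; have [d d0 dP] := irrational_multiples_away J irr.
(* Two visits within d / 2 of integers, at times i < j, put (j - i) * alpha within d of an
   integer. *)
exists (d / 2) => [|t T]; first by rewrite divr_gt0.
apply: card_separated => // i j /asboolP[p ip] /asboolP[q jq] ij.
rewrite leqNgt; apply/negP => jiJ.
have /(dP _ (q - p)) : (0 < j - i < J)%N by rewrite subn_gt0 ij.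
apply/negP; rewrite -leNgt natrB 1?ltnW// mulrBl rmorphB/=.
move: ip jq; rewrite !ler_norml; lra.
Qed.

(** The index tells which of N equal arcs of the circle contains the angle at time k. A rotation
    preserves distances, so equal indices keep two orbits of angles close forever. Up to a constant
    integer, their roundings then differ only when an integer is near the angle, and
    [card_near_integer] bounds the number of such times. The offset [c] serves to read coordinates
    other than 0. *)
Lemma sturmian_finite_classes (s : biseq) (J : nat) : (0 < J)%N ->
  sturmian_sequence (R := R) s ->
  exists N (idx : int -> 'I_N), forall k k', idx k = idx k' ->
    forall (c : int) (T : nat),
      (#|[pred t : 'I_T | s (k + c + t%:Z)%R != s (k' + c + t%:Z)%R]|
       <= ((T %/ J).+1).*2)%N.
Proof.
move=> J0 /sturmian_rounding [alpha [rho [F [irr [Fq _ Fjump] sE]]]].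
have [d d0 near_int] := card_near_integer J0 irr.
pose M := Num.truncn d^-1.
have Md : (M.+1%:R)^-1 < d.
  by rewrite invf_plt ?posrE//; exact: truncnS_gt.
pose th (k : int) := rho + k%:~R * alpha.
pose fr (k : int) := th k - (Num.floor (th k))%:~R.
have fr0 k : 0 <= fr k by rewrite subr_ge0 floor_le.
have fr1 k : fr k < 1.
  by have := floorD1_gt (th k); rewrite rmorphD/= /fr; lra.
have lt_idx k : (Num.truncn (M.+1%:R * fr k) < M.+1)%N.
  by rewrite truncn_lt_nat ?mulr_ge0// -[ltRHS]mulr1 ltr_pM2l.
exists M.+1, (fun k => Ordinal (lt_idx k)) => k k' [/= eqidx] c T.
(* The angles are lifted to the line, and [q] is the integer by which the two lifts are offset. *)
pose q := Num.floor (th k) - Num.floor (th k').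
have thq : `|th k - (th k' + q%:~R)| <= d.
  have -> : th k - (th k' + q%:~R) = fr k - fr k'.
    by rewrite /fr /q rmorphB/=; lra.
  apply: le_trans (ltW Md).
  rewrite -[_^-1]mul1r ler_pdivlMr// mulrC -[X in X * _]ger0_norm// -normrM mulrBr.
  have := truncn_itv (mulr_ge0 (ler0n R M.+1) (fr0 k)).
  have := truncn_itv (mulr_ge0 (ler0n R M.+1) (fr0 k')).
  rewrite -eqidx -natr1 ler_norml => /andP[? ?] /andP[? ?]; lra.
have thD (k0 : int) n : th (k0 + c + n) = th (k0 + c) + n%:~R * alpha.
  by rewrite /th rmorphD/= mulrDl addrA.
have thc n : `|th (k + n) - (th (k' + n) + q%:~R)| <= d.
  suff -> : th (k + n) - (th (k' + n) + q%:~R) = th k - (th k' + q%:~R) by [].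
  rewrite /th !rmorphD/=; lra.
have jump n : F (th (k + n)) != F (th (k' + n)) + q ->
    exists p : int, `|th (k + n) - p%:~R| <= d.
  rewrite -Fq; have := thc n.
  have [le_t ut ne|/ltW le_t ut ne] := leP (th (k + n)) (th (k' + n) + q%:~R).
    have [p /andP[p1 p2]] := Fjump _ _ le_t ne; exists p.
    by move: ut; rewrite !ler_norml; lra.
  rewrite eq_sym in ne.
  have [p /andP[p1 p2]] := Fjump _ _ le_t ne; exists p.
  by move: ut; rewrite !ler_norml; lra.
rewrite -addnn.
apply: leq_trans (leq_add (near_int (th (k + c)) T) (near_int (th (k + c + 1)) T)).
rewrite -cardUI (leq_trans _ (leq_addr _ _))// subset_leq_card//.
apply/fintype.subsetP => t; rewrite !inE => ne.
(* A symbol is the difference of two consecutive roundings, so distinct symbols need a discrepancy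
   in one of the two; this is the source of the factor 2. *)
have : F (th (k + c + t%:Z)) != F (th (k' + c + t%:Z)) + q \/
    F (th (k + c + t%:Z + 1)) != F (th (k' + c + t%:Z + 1)) + q.
  apply/orP; apply: contraNT ne; rewrite negb_or !negbK => /andP[/eqP e1 /eqP e2].
  suff : (s (k + c + t%:Z) : nat)%:Z = (s (k' + c + t%:Z) : nat)%:Z.
    by case: (s _); case: (s _).
  by rewrite !sE -!/(th _) e1 e2 opprD addrACA subrr addr0.
case; rewrite -!addrA => /jump[p]; rewrite !addrA => le_p; apply/orP; [left|right].
  by apply/asboolP; exists p; rewrite pmulrn -thD.
apply/asboolP; exists p; rewrite pmulrn.
suff <- : th (k + c + t%:Z + 1) = th (k + c + 1) + t%:~R * alpha by [].
by rewrite -!addrA (addrC _ 1) !addrA /th !rmorphD/=; lra.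
Qed.
End Rotation.

(** * Topology of the subshift *)

Lemma agree_le (m n : nat) (x y : biseq) : (m <= n)%N -> agree n x y -> agree m x y.
Proof. by move=> mn xy i im; apply: xy; apply: leq_trans mn. Qed.

Lemma agree_sym (m : nat) (x y : biseq) : agree m x y -> agree m y x.
Proof. by move=> xy i im; rewrite xy. Qed.

Lemma agree_trans (m : nat) (x y z : biseq) : agree m x y -> agree m y z -> agree m x z.
Proof. by move=> xy yz i im; rewrite xy ?yz. Qed.

Section SubshiftTopology.
Context {R : realType} (s : biseq).
Implicit Types (x y : subshift s) (U : set (subshift s)).

Lemma biseq_dist_half_expr (x y : biseq) (m : nat) :
  biseq_dist x y < 2^-1 ^+ m :> R -> agree m x y.
Proof.
move=> /biseq_dist_ltP[n xy].
by rewrite ltr_iXn2l ?invr_gt0 ?invf_lt1 ?ltr1n// => /ltnW mn; exact: agree_le xy.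
Qed.

Lemma subshift_ballE x y (e : R) : ball x e y = (biseq_dist (val x) (val y) < e).
Proof. by []. Qed.

Lemma subshift_openP U :
  open U <-> forall x, U x -> exists m, forall y, agree m (val x) (val y) -> U y.
Proof.
rewrite openE; split=> h x Ux.
  have /(nbhs_ballP (R := R))[e /= /half_expr_lt[m me] eU] := h x Ux.
  exists m => y xy; apply: eU; rewrite subshift_ballE.
  by apply/biseq_dist_ltP; exists m.
have [m mU] := h x Ux; apply/(nbhs_ballP (R := R)).
exists (2^-1 ^+ m) => /=; first exact: half_expr_gt0.
by move=> y; rewrite subshift_ballE => /biseq_dist_half_expr/mU.
Qed.

Lemma subshift_agree_orbit x (m : nat) : exists k, agree m (val x) (shift_by k s).
Proof.
have /(_ _ (nbhsx_ballx (val x) _ (half_expr_gt0 (R := R) m))) := set_valP x.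
by move=> [_ [[k _ <-] /biseq_dist_half_expr xk]]; exists k.
Qed.

Lemma mem_orbit (k : int) : shift_by k s \in orbit_closure s.
Proof. by apply/mem_set/subset_closure; exists k. Qed.

Definition orbit_point (k : int) : subshift s := exist _ (shift_by k s) (mem_orbit k).

Lemma val_iter_subshift_map (t : nat) x (n : int) :
  val (iter t (@subshift_map s) x) n = val x (n + t%:Z).
Proof.
elim: t n => [|t IH] n; first by rewrite addr0.
rewrite iterS.
change (val (iter t (@subshift_map s) x) (n + 1) = val x (n + t.+1%:Z)).
by rewrite IH -addrA -intS.
Qed.

End SubshiftTopology.

(** * Invariant measures *)

(** Continuity from above: the tails decrease to the empty set. *)
Lemma bigcup_tail_lt d (T : measurableType d) (R : realType)
    (mu : probability T R) (B : (set T)^nat) (e : R) :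
  (forall n, measurable (B n)) -> {homo B : n m / (n <= m)%N >-> n `<=` m} ->
  0 < e -> exists N, (mu (\bigcup_n B n `\` B N) < e%:E)%E.
Proof.
move=> mB ndB e0; pose F n := \bigcup_n B n `\` B n.
have mU : measurable (\bigcup_n B n) by exact: bigcupT_measurable.
have mF n : measurable (F n) by exact: measurableD.
have F0 : \bigcap_n F n = set0.
  apply/seteqP; split=> // x xF; have [[n _ Bnx] _] := xF 0%N I.
  by have [_] := xF n I.
have : (mu \o F) n @[n --> \oo] --> mu (\bigcap_n F n).
  apply: nonincreasing_cvg_mu => //.
  - by rewrite (le_lt_trans (probability_le1 _ _))// ltry.
  - by rewrite F0.
  - by move=> n m nm; apply/subsetPset => x [xU xB]; split=> // /(ndB _ _ nm).
rewrite F0 measure0 => /(_ [set x | x < e%:E]%E).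
case.
  apply: open_nbhs_nbhs; split; first exact: open_ereal_lt_ereal.
  by rewrite /= lte_fin.
by move=> N _ /(_ N (leqnn N)); exists N.
Qed.

Section Markov.
Context d (X : measurableType d) (R : realType) (mu : probability X R).
Variable f : X -> X.
Hypotheses (mf : measurable_fun setT f) (pf : measure_preserving mu f).

Lemma measurable_fun_iter t : measurable_fun setT (iter t f).
Proof.
elim: t => [|t IH]; first exact: measurable_id.
by rewrite (_ : iter t.+1 f = f \o iter t f)//; exact: measurableT_comp.
Qed.

Lemma measurable_iter_preimage t (A : set X) :
  measurable A -> measurable (iter t f @^-1` A).
Proof. by move=> mA; rewrite -[_ @^-1` _]setTI; exact: measurable_fun_iter. Qed.

Lemma measure_iter_preimage t (A : set X) :
  measurable A -> mu (iter t f @^-1` A) = mu A.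
Proof.
move=> mA; elim: t => [|t IH]; first by [].
rewrite -IH -[RHS]pf; last exact: measurable_iter_preimage.
congr (mu _); apply/funext => x.
by rewrite /preimage/= -[f (iter t f x)]/(iter t.+1 f x) iterSr.
Qed.

Definition visits (E : set X) (T : nat) (x : X) : nat :=
  #|[pred t : 'I_T | `[< E (iter t f x) >]]|.

Lemma visitsE E T x : (visits E T x)%:R =
  \sum_(t < T) \1_(iter t f @^-1` E) x :> R.
Proof.
rewrite /visits -sum1_card natr_sum big_mkcond/=; apply: eq_bigr => t _.
rewrite inE /= indicE; case: ifPn => [/asboolP h|/asboolPn h].
  by rewrite mem_set.
by rewrite memNset.
Qed.

Lemma measurable_fun_visits E T : measurable E ->
  measurable_fun setT (fun x => (visits E T x)%:R : R).
Proof.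
move=> mE; rewrite (_ : (fun x => _) = fun x => \sum_(t < T) \1_(iter t f @^-1` E) x).
  apply: measurable_sum => t; apply: measurable_indic.
  exact: measurable_iter_preimage.
by apply/funext => x; exact: visitsE.
Qed.

(** Markov's inequality for the number of visits, whose integral is T * mu E by invariance. *)
Lemma visits_markov E T (eta : R) : measurable E -> (0 < T)%N -> 0 < eta ->
  (eta%:E * mu [set x | eta * T%:R <= (visits E T x)%:R]%R <= mu E)%E.
Proof.
move=> mE T0 eta0; set A := [set x | _].
have T0' : 0 < T%:R :> R by rewrite ltr0n.
have mA : measurable A.
  rewrite -[A]setTI; apply: measurable_fun_le => //.
  exact: measurable_fun_visits.
have : ((eta * T%:R)%:E * mu A <= T%:R%:E * mu E)%E.
  have -> : (T%:R%:E * mu E = \int[mu]_x (visits E T x)%:R%:E)%E.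
    under eq_integral do rewrite visitsE -sumEFin.
    rewrite ge0_integral_sum//.
    - rewrite (eq_bigr (fun=> mu E)) => [|t _].
        by rewrite sumr_const card_ord mule_natl.
      rewrite integral_indic ?setIT//; last exact: measurable_iter_preimage.
      exact: measure_iter_preimage.
    - move=> t; apply/measurable_EFinP; apply: measurable_indic.
      exact: measurable_iter_preimage.
  have mv : measurable_fun setT (fun x => (visits E T x)%:R%:E : \bar R).
    by apply/measurable_EFinP; exact: measurable_fun_visits.
  apply: (@le_trans _ _ (\int[mu]_(x in A) (visits E T x)%:R%:E)%E); last first.
    by apply: ge0_subset_integral => // x _; rewrite lee_fin.
  rewrite -integral_cst//; apply: ge0_le_integral => //.
  - by move=> x _; rewrite lee_fin mulr_ge0 ?ltW.
  - exact: measurable_funTS.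
by rewrite EFinM muleAC (muleC _ T%:R%:E) lee_pmul2l.
Qed.

End Markov.

(** * Approximation by cylinders *)

Section CylinderApproximation.
Context {R : realType} (s : biseq).
Let X := g_sigma_algebraType (@open (subshift s)).
Variable mu : probability X R.
Implicit Types (A E : set X).

(* Off E, membership in A depends only on the coordinates |n| < m. *)
Definition determined_off (m : nat) E A : Prop :=
  forall x y : subshift s, ~ E x -> ~ E y -> agree m (val x) (val y) -> A x -> A y.

Definition approximable A : Prop := forall e : R, 0 < e ->
  exists E m, [/\ measurable E, (mu E < e%:E)%E & determined_off m E A].

Lemma determined_off_le m n E F A : (m <= n)%N -> E `<=` F ->
  determined_off m E A -> determined_off n F A.
Proof.
move=> mn EF AE x y Fx Fy xy; apply: AE; last exact: agree_le xy.
  by move/EF.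
by move/EF.
Qed.

Lemma small_measureU E F (e : R) : measurable E -> measurable F ->
  (mu E < (e / 2)%:E)%E -> (mu F < (e / 2)%:E)%E -> (mu (E `|` F) < e%:E)%E.
Proof.
move=> mE mF E2 F2; apply: le_lt_trans (measureU2 _ _ _) _ => //.
by rewrite [e in e%:E]splitr EFinD lteD.
Qed.

Lemma approximableU A B : approximable A -> approximable B -> approximable (A `|` B).
Proof.
move=> aA aB e e0; have e20 : 0 < e / 2 by rewrite divr_gt0.
have [E [m [mE Ee EA]]] := aA _ e20; have [F [n [mF Fe FB]]] := aB _ e20.
exists (E `|` F), (maxn m n); split.
- exact: measurableU.
- exact: small_measureU.
- move=> x y Ex Ey xy [Ax|Bx]; [left|right].
    by apply: (determined_off_le (leq_maxl m n) (@subsetUl _ E F) EA) xy Ax.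
  by apply: (determined_off_le (leq_maxr m n) (@subsetUr _ E F) FB) xy Bx.
Qed.

(** Some [B N] fills the union up to a small measure; the rest of the union joins the exceptional
    set of [B N]. *)
Lemma approximable_limit (B : (set X)^nat) :
  (forall n, measurable (B n)) -> {homo B : n m / (n <= m)%N >-> n `<=` m} ->
  (forall n, approximable (B n)) -> approximable (\bigcup_n B n).
Proof.
move=> mB ndB aB e e0; have e20 : 0 < e / 2 by rewrite divr_gt0.
have [N BN] := bigcup_tail_lt mu mB ndB e20.
have [E [m [mE Ee EA]]] := aB N _ e20.
have mD : measurable (\bigcup_n B n `\` B N).
  by apply: measurableD => //; exact: bigcupT_measurable.
exists (E `|` (\bigcup_n B n `\` B N)), m; split.
- exact: measurableU.
- exact: small_measureU.
- move=> x y Ex Ey xy Ux; exists N => //; apply: EA xy _.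
  + by move=> ?; apply: Ex; left.
  + by move=> ?; apply: Ey; left.
  + by apply: contrapT => nBx; apply: Ex; right.
Qed.

Lemma determined_open m (A : set X) : determined_off m set0 A -> measurable A.
Proof.
move=> dA; apply: sub_sigma_algebra.
by apply/(subshift_openP (R := R)) => x Ax; exists m => y xy; apply: dA xy Ax.
Qed.

(** An open set is the increasing union of the cylinders inside it, and cylinders have an empty
    exceptional set. *)
Lemma approximable_open (U : set (subshift s)) : open U -> approximable U.
Proof.
move=> /(subshift_openP (R := R)) oU.
pose B m : set X := [set x | forall y : subshift s, agree m (val x) (val y) -> U y].
have dB m : determined_off m set0 (B m).
  by move=> x y _ _ xy Bx z yz; apply: Bx; exact: agree_trans xy yz.
have -> : U = \bigcup_m B m.
  apply/seteqP; split => [x Ux|x [m _]]; last by apply.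
  by have [m mU] := oU x Ux; exists m.
apply: approximable_limit => [n|n m nm x Bx y xy|n].
- exact: determined_open (dB n).
- by apply: Bx; exact: agree_le xy.
- by move=> e e0; exists set0, n; split; rewrite ?measure0 ?lte_fin.
Qed.

Lemma measurable_approximable A : measurable A -> approximable A.
Proof.
(* The sets with both properties form a sigma-algebra containing the open sets. Measurability is
   carried along because [approximable_limit] asks for it. *)
move=> mA; suff [] : measurable A /\ approximable A by [].
move: A mA; apply: smallest_sub; last first.
  by move=> U oU; split; [exact: sub_sigma_algebra|exact: approximable_open].
split.
- by split => // e e0; exists set0, 0%N; split; rewrite ?measure0 ?lte_fin.
- move=> A [mA aA]; rewrite setTD; split; first exact: measurableC.
  move=> e /aA[E [m [mE Ee EA]]]; exists E, m; split=> // x y Ex Ey xy nAx Ay.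
  by apply: nAx; apply: EA Ey Ex _ Ay; exact: agree_sym.
- move=> A0; pose A : (set X)^nat := A0; rewrite -[A0]/A => mA.
  have mA1 n : measurable (A n) by case: (mA n).
  split; first exact: bigcupT_measurable.
  (* Partial unions turn the union into an increasing one. *)
  pose B n : set X := \big[setU/set0]_(i < n) A i.
  have -> : \bigcup_n A n = \bigcup_n B n.
    apply/seteqP; split=> x [n _ Ax].
      by exists n.+1 => //; rewrite /B big_ord_recr/=; right.
    by move: Ax; rewrite /B -bigcup_mkord => -[k _ Ak]; exists k.
  apply: approximable_limit => [n|n m nm|n].
  + exact: bigsetU_measurable.
  + exact: subset_bigsetU.
  + rewrite /B; elim/big_ind: _ => [|? ?|i _]; [|exact: approximableU|by case: (mA i)].
    by move=> e e0; exists set0, 0%N; split; rewrite ?measure0 ?lte_fin.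
Qed.

Lemma approximable_finite k (P : 'I_k -> set X) (e : R) :
  (forall i, measurable (P i)) -> 0 < e ->
  exists E m, [/\ measurable E, (mu E < e%:E)%E & forall i, determined_off m E (P i)].
Proof.
move=> mP.
suff H (l : seq 'I_k) : 0 < e -> exists E m, [/\ measurable E, (mu E < e%:E)%E &
    forall i, i \in l -> determined_off m E (P i)].
  move=> /(H (enum 'I_k))[E [m [mE Ee EP]]]; exists E, m; split => // i.
  by apply: EP; rewrite mem_enum.
elim: l e => [|i l IH] e e0.
  by exists set0, 0%N; split; rewrite ?measure0 ?lte_fin.
have e20 : 0 < e / 2 by rewrite divr_gt0.
have [E [m [mE Ee EP]]] := IH _ e20.
have [F [n [mF Fe FP]]] := measurable_approximable (mP i) e20.
exists (E `|` F), (maxn m n); split.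
- exact: measurableU.
- exact: small_measureU.
- move=> j; rewrite inE => /orP[/eqP ->|jl].
    exact: determined_off_le (leq_maxr m n) (@subsetUr _ E F) FP.
  exact: determined_off_le (leq_maxl m n) (@subsetUl _ E F) (EP j jl).
Qed.

Lemma measurable_subshift_map : measurable_fun setT (@subshift_map s : X -> X).
Proof.
apply: (@measurability _ _ X X setT _ (@open (subshift s))) => //.
move=> _ [U /(subshift_openP (R := R)) oU <-]; rewrite setTI.
apply: sub_sigma_algebra; apply/(subshift_openP (R := R)) => x Ux.
(* The shift moves coordinates by 1, so the window grows by 1. *)
have [m mU] := oU _ Ux; exists m.+1 => y xy; apply: mU => n nm.
rewrite /= /shift /shift_by; apply: xy; lia.
Qed.

End CylinderApproximation.

(** * Hamming covering numbers *)

Lemma card_pred_sum (T : finType) (p : pred T) :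
  #|[pred x | p x]| = (\sum_x p x)%N.
Proof.
by rewrite -sum1_card big_mkcond/=; apply: eq_bigr => x _; rewrite inE; case: (p x).
Qed.

Lemma measurable_ltr_set d (X : measurableType d) (R : realType) (g h : X -> R) :
  measurable_fun setT g -> measurable_fun setT h ->
  measurable [set x | g x < h x].
Proof.
move=> mg mh; rewrite (_ : [set x | _] = ~` [set x | h x <= g x]).
  by apply: measurableC; rewrite -[X in measurable X]setTI; exact: measurable_fun_le.
by apply/seteqP; split=> x /=; rewrite ltNge => /negP.
Qed.

Section HammingMeasurable.
Context d (X : measurableType d) (R : realType) (mu : probability X R).
Variable f : X -> X.
Hypothesis mf : measurable_fun setT f.
Variables (k : nat) (P : 'I_k -> set X).
Hypothesis partP : measurable_partition P.

Lemma symbol_at_eqP t x y : symbol_at f P t x = symbol_at f P t y <->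
  exists2 i, P i (iter t f x) & P i (iter t f y).
Proof.
have [mP tP cP] := partP.
have symE z i : P i (iter t f z) -> symbol_at f P t z = Some i.
  move=> Pz; rewrite /symbol_at; case: pickP => [j|/(_ i)]; last by rewrite mem_set.
  by move=> /set_mem Pj; congr Some; apply: (tP j i I I); exists (iter t f z).
split=> [e|[i xi yi]]; last by rewrite (symE _ _ xi) (symE _ _ yi).
have [i _ xi] : (\bigcup_i P i) (iter t f x) by rewrite cP.
have [j _ yj] : (\bigcup_i P i) (iter t f y) by rewrite cP.
exists i => //; move: e; rewrite (symE _ _ xi) (symE _ _ yj).
by case=> ->.
Qed.

Lemma measurable_symbol_neq t x :
  measurable [set y | symbol_at f P t x != symbol_at f P t y].
Proof.
have [mP tP cP] := partP.
have [i _ xi] : (\bigcup_i P i) (iter t f x) by rewrite cP.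
rewrite (_ : [set y | _] = ~` (iter t f @^-1` P i)).
  by apply: measurableC; exact: measurable_iter_preimage.
apply/seteqP; split=> y /=.
  by move=> /eqP ne yi; apply: ne; apply/symbol_at_eqP; exists i.
move=> ny; apply/eqP => /symbol_at_eqP[j xj yj]; apply: ny.
by rewrite (tP i j I I)//; exists (iter t f x).
Qed.

Lemma measurable_hamming_ball T x (e : R) :
  measurable [set y | hamming_dist f P T x y < e].
Proof.
pose A t : set X := [set y | symbol_at f P t x != symbol_at f P t y].
have -> : [set y | hamming_dist f P T x y < e] =
    [set y | (\sum_(t < T) \1_(A t) y) / T%:R < e :> R].
  apply/funext => y; rewrite /hamming_dist/= card_pred_sum natr_sum.
  congr ((_ / _ < _) : Prop); apply: eq_bigr => t _.
  by rewrite indicE mem_setE.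
apply: measurable_ltr_set => //.
apply: measurable_funM => //; apply: measurable_sum => t.
by apply: measurable_indic; exact: measurable_symbol_neq.
Qed.

End HammingMeasurable.

Section MetricCovering.
Context {R : realType} (s : biseq).
Let X := g_sigma_algebraType (@open (subshift s)).
Variable mu : probability X R.
Let f : X -> X := @subshift_map s.

(** At a time when neither orbit is in [E], distinct symbols force distinct coordinates at some
    offset between -m and m. The bound is the sum over all times, with the two summations
    exchanged. *)
Lemma hamming_count_le k (P : 'I_k -> set X) (E : set X) (m T : nat) (x y : X) :
  (forall i, determined_off m E (P i)) ->
  (#|[pred t : 'I_T | symbol_at f P t x != symbol_at f P t y]| <=
   visits f E T x + visits f E T y +
   \sum_(j < m.*2.+1) #|[pred t : 'I_T |
      val (x : subshift s) (j%:Z - m%:Z + t%:Z)%R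
      != val (y : subshift s) (j%:Z - m%:Z + t%:Z)%R]|)%N.
Proof.
move=> EP; rewrite /visits !card_pred_sum.
under [X in (_ <= _ + X)%N]eq_bigr do rewrite card_pred_sum.
rewrite exchange_big -!big_split; apply: leq_sum => /= t _.
case: (boolP (symbol_at f P t x != _)) => // ne; rewrite addn_gt0.
have [Ex|nEx] := asboolP (E (iter t f x)); first by [].
have [Ey|nEy] := asboolP (E (iter t f y)); first by [].
rewrite /= lt0n; apply: contraNN ne => /eqP/eqP; rewrite sum_nat_eq0 => /forallP ag.
have {}ag : agree m (val (iter t f x : subshift s)) (val (iter t f y : subshift s)).
  move=> n nm; rewrite !val_iter_subshift_map.
  have jm : (`|(n + m%:Z)%R|%N < m.*2.+1)%N by lia.
  have := ag (Ordinal jm); rewrite /= eqb0 negbK.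
  have -> : `|(n + m%:Z)%R|%N%:Z - m%:Z + t%:Z = n + t%:Z :> int by lia.
  by move=> /eqP.
rewrite /symbol_at; apply/eqP; apply: eq_pick => i /=.
apply/idP/idP => /set_mem h; apply/mem_set.
  exact: EP nEx nEy ag h.
by apply: EP nEy nEx _ h; exact: agree_sym.
Qed.

(** One centre for each class of [sturmian_finite_classes] is enough, and the number of classes
    depends on [J] but not on [T]. The balls cover the set [G] of points that rarely visit [E]. *)
Lemma hamming_covering_number_bounded k (P : 'I_k -> set X) (e : R) :
  sturmian_sequence (R := R) s -> measure_preserving mu f ->
  measurable_partition P -> 0 < e ->
  exists N T0, forall T, (T0 <= T)%N ->
    (hamming_covering_number mu f P e T <= N%:R%:E)%E.
Proof.
move=> st pf partP e0; have [mP _ _] := partP.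
have mf : measurable_fun setT f by exact: measurable_subshift_map.
(* The error budget: the two visit counts stay below e * T / 8 each. The choice of [J] bounds the
   coordinate discrepancies 2 * M * (T %/ J + 1) by e * T / 4 for the quotient and, as J <= T, by e
   * T / 4 for the extra 1. The sum is below e * T. Since mu E < eta * e, Markov's inequality leaves
   less than e outside [G]. *)
pose eta := e / 8.
have eta0 : 0 < eta by rewrite divr_gt0.
have [E [m [mE Ee EP]]] := approximable_finite mu mP (mulr_gt0 eta0 e0).
pose M := m.*2.+1.
pose J := (Num.truncn (8 * M%:R / e)).+1.
have [N [idx idxP]] := sturmian_finite_classes (ltn0Sn _ : 0 < J)%N st.
exists N, J => T JT.
have T0 : (0 < T)%N by exact: leq_trans JT.
have T0' : 0 < T%:R :> R by rewrite ltr0n.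
have MJ : 8 * M%:R < e * J%:R :> R.
  by rewrite (mulrC e) -ltr_pdivrMr//; exact: truncnS_gt.
pose G : set X := [set x | (visits f E T x)%:R < eta * T%:R].
have GC : ~` G = [set x | eta * T%:R <= (visits f E T x)%:R].
  by apply/seteqP; split=> x /=; rewrite leNgt => /negP.
have mG : measurable G.
  apply: measurable_ltr_set => //.
  exact: measurable_fun_visits.
have muG : ((1 - e)%:E < mu G)%E.
  have : (mu (~` G) < e%:E)%E.
    rewrite -(@lte_pmul2l _ eta%:E)// GC.
    by apply: le_lt_trans Ee; exact: visits_markov.
  rewrite probability_setC//.
  by rewrite -(fineK (fin_num_measure mu _ mG)) -EFinB !lte_fin; lra.
(* During T steps only coordinates |n| < T + m are read, and there each point agrees with a
   translate of [s], which has a class. *)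
have /choice[kk kkP] : forall x : X, exists k,
    agree (T + m) (val (x : subshift s)) (shift_by k s).
  by move=> x; exact: (subshift_agree_orbit (R := R)).
(* The centre is taken in [G] whenever the class meets [G]; for the other classes any point will
   do. *)
have /choice[c cP] : forall i : 'I_N, exists x : X,
    (exists2 y, G y & idx (kk y) = i) -> G x /\ idx (kk x) = i.
  move=> i; have [[y Gy yi]|ny] := pselect (exists2 y, G y & idx (kk y) = i).
    by exists y.
  by exists point.
rewrite /hamming_covering_number.
apply: ge_ereal_inf; exists N%:R%:E => //; exists N => //; exists c.
apply: lt_le_trans muG _; apply: le_measure; rewrite ?inE//.
  apply: fin_bigcup_measurable => // i _; exact: measurable_hamming_ball.
move=> y Gy; exists (idx (kk y)) => //=.
have [Gc ic] : G (c (idx (kk y))) /\ idx (kk (c (idx (kk y)))) = idx (kk y).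
  by apply: cP; exists y.
move: (c _) Gc ic => x Gx ic.
rewrite /hamming_dist ltr_pdivrMr//.
have := hamming_count_le T x y EP.
rewrite -(ler_nat R) => /le_lt_trans; apply.
rewrite !natrD.
have : (\sum_(j < M) #|[pred t : 'I_T |
      val (x : subshift s) (j%:Z - m%:Z + t%:Z)%R
      != val (y : subshift s) (j%:Z - m%:Z + t%:Z)%R]| <= M * ((T %/ J).+1).*2)%N.
  rewrite -[X in (X * _)%N]card_ord -sum_nat_const; apply: leq_sum => j _.
  apply: leq_trans (idxP _ _ ic (j%:Z - m%:Z) T).
  rewrite (eq_card (B := [pred t : 'I_T | s (kk x + (j%:Z - m%:Z) + t%:Z)
    != s (kk y + (j%:Z - m%:Z) + t%:Z)]))// => t; rewrite !inE.
  have small : (`|(j%:Z - m%:Z + t%:Z)%R|%N < T + m)%N.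
    by have := ltn_ord t; have := ltn_ord j; rewrite /M; lia.
  by rewrite !kkP// /shift_by !addrA ![_ + kk _]addrC !addrA.
rewrite -(ler_nat R) natrM -addnn natrD -[(T %/ J).+1%:R]natr1 => le_sum.
move: Gx Gy; rewrite /G/= => Gx Gy.
have qT : J%:R * (T %/ J)%:R <= T%:R :> R.
  by rewrite -natrM ler_nat mulnC leq_divM.
have JT' : J%:R <= T%:R :> R by rewrite ler_nat.
have h1 : 8 * M%:R * (T %/ J)%:R <= e * T%:R :> R.
  apply: (@le_trans _ _ (e * J%:R * (T %/ J)%:R)).
    by rewrite ler_wpM2r// ltW.
  by rewrite -mulrA ler_wpM2l// ltW.
have h2 : e * J%:R <= e * T%:R by rewrite ler_wpM2l// ltW.
have h3 : 0 < e * T%:R by rewrite mulr_gt0.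
rewrite /eta in Gx Gy; move: le_sum; rewrite -/M; set S := (_%:R : R).
lra.
Qed.

End MetricCovering.

(** * Scales and word complexity *)

Section Scales.
Context {R : realType}.
Implicit Types (u v : nat -> \bar R) (a : R -> R -> R).

Lemma le_limn_esup u v : (\forall n \near \oo, (u n <= v n)%E) ->
  (limn_esup u <= limn_esup v)%E.
Proof.
move=> [N _ uv]; apply: le_ereal_inf_tmp => _ [V [M _ MV] <-].
apply: ge_ereal_inf; exists (ereal_sup [set u n | n in [set n | (maxn N M <= n)%N]]).
  by exists [set n | (maxn N M <= n)%N] => //; exists (maxn N M).
apply: ge_ereal_sup => _ [n /= nNM <-].
apply: le_ereal_sup_tmp; exists (v n); last by apply: uv => /=; lia.
by exists n => //; apply: MV => /=; lia.
Qed.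

(** Every scale tends to infinity, so its quotient with a bounded sequence has limsup at most 0 and
    only the adjoined 0 remains. *)
Lemma growth_exponent_bounded a u (N : nat) : scale_family a ->
  (\forall T \near \oo, (u T <= N%:R%:E)%E) -> growth_exponent a u = 0%E.
Proof.
move=> [a0 aoo _] uN; apply/eqP; rewrite eq_le; apply/andP; split; last first.
  by apply: ereal_sup_ubound; left.
apply: ge_ereal_sup => _ [->//|[chi [chi0 pos] <-]]; exfalso.
move: pos; apply/negP; rewrite -leNgt.
have : (N%:R * (a chi T%:R)^-1)%:E @[T --> \oo] --> (0%E : \bar R).
  apply/cvg_EFin; first by near=> T.
  rewrite -[X in _ --> X](mulr0 N%:R); apply: cvgMl_tmp.
  apply/gtr0_cvgV0; last exact: (cvg_comp _ _ cvgr_idn (aoo _ chi0)).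
  by exists 1%N => // T /= T0; apply: a0 => //; rewrite ltr0n.
move=> lim0; have [_ <-] := cvg_limn_einf_sup lim0; apply: le_limn_esup.
near=> T; rewrite EFinM; apply: lee_wpmul2r.
  by rewrite lee_fin invr_ge0 ltW// a0// ltr0n; near: T; exists 1%N.
by near: T.
Unshelve. all: by end_near. Qed.

Lemma growth_exponent_ge a u (chi : R) : scale_family a -> 0 < chi ->
  (\forall T \near \oo, ((a chi T%:R)%:E <= u T)%E) ->
  (chi%:E <= growth_exponent a u)%E.
Proof.
move=> [a0 _ _] chi0 au; apply: ereal_sup_ubound; right; exists chi => //; split=> //.
apply: (@lt_le_trans _ _ 1%E) => //.
have [_ <-] := cvg_limn_einf_sup (cvg_cst (1%E : \bar R)).
apply: le_limn_esup; near=> T.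
have aT : 0 < a chi T%:R by rewrite a0// ltr0n; near: T; exists 1%N.
rewrite -[leLHS](_ : ((a chi T%:R)%:E * ((a chi T%:R)^-1)%:E = 1)%E); last first.
  by rewrite -EFinM mulfV ?gt_eqF.
apply: lee_wpmul2r; first by rewrite lee_fin invr_ge0 ltW.
by near: T.
Unshelve. all: by end_near. Qed.

Lemma le_growth_exponent a u v : scale_family a ->
  (forall T, (u T <= v T)%E) -> (growth_exponent a u <= growth_exponent a v)%E.
Proof.
move=> [a0 _ _] uv; apply: ereal_sup_le => _ [->|[chi [chi0 pos] <-]]; first by left.
right; exists chi => //; split=> //; apply: lt_le_trans pos _.
(* The scales are known to be positive at positive times only, so T = 0 is left out. *)
apply: le_limn_esup; exists 1%N => // T /= T0.
by apply: lee_wpmul2r => //; rewrite lee_fin invr_ge0 ltW// a0// ltr0n.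
Qed.

Definition power_scale (g : nat -> nat) (chi t : R) : R :=
  (g (Num.truncn t))%:R `^ chi.

(** The quotient of the scales for chi < chi' is the inverse of the scale for chi' - chi. *)
Lemma power_scale_family (g : nat -> nat) : (forall n, (0 < g n)%N) ->
  g n @[n --> \oo] --> \oo -> scale_family (power_scale g).
Proof.
move=> g0 goo.
have pos chi t : 0 < power_scale g chi t by rewrite powR_gt0// ltr0n.
have oo chi : 0 < chi -> power_scale g chi t @[t --> +oo] --> +oo.
  move=> chi0; apply/cvgryPge => A.
  (* With this choice K to the power chi is at least |A|. *)
  pose K := (Num.truncn (`|A| `^ chi^-1)).+1.
  have [N _ NK] : \forall n \near \oo, (K <= g n)%N.
    by apply: (goo [set n | (K <= n)%N]); exists K.
  have : \forall t \near +oo, N%:R <= t :> R by exact: nbhs_pinfty_ge.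
  apply: filterS => t Nt.
  have tK : (K <= g (Num.truncn t))%N.
    by apply: NK => /=; rewrite truncn_ge_nat// (le_trans _ Nt).
  rewrite (le_trans (ler_norm A))//.
  rewrite -[`|A|]powRr1// -(mulVf (lt0r_neq0 chi0)) powRrM.
  rewrite ge0_ler_powR ?nnegrE ?powR_ge0 ?(ltW chi0)//.
  by rewrite (le_trans (ltW (truncnS_gt _)))// ler_nat.
split=> // chi chi' chi0 lt_chi.
rewrite (_ : (fun t => _) = fun t => (power_scale g (chi' - chi) t)^-1).
  apply/gtr0_cvgV0; last by apply: oo; rewrite subr_gt0.
  by near=> t.
apply/funext => t; rewrite /power_scale -powRB ?pnatr_eq0 -?lt0n ?g0 ?implybT//.
by rewrite -powRN opprB.
Unshelve. all: by end_near. Qed.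

End Scales.

(** The factor complexity of the two-sided sequence. *)
Definition word_count (s : biseq) (n : nat) : nat :=
  #|[pred w : {ffun 'I_n -> bool} |
      `[< exists k : int, w = [ffun i : 'I_n => s (k + i%:Z)%R] >]]|.

Lemma word_count_gt0 s n : (0 < word_count s n)%N.
Proof.
apply/card_gt0P => /=; exists [ffun i : 'I_n => s (0 + i%:Z)].
by rewrite unfold_in /=; apply/asboolP; exists 0.
Qed.

(** The translates of an aperiodic sequence are pairwise distinct, so a window wide enough to
    separate K of them shows K distinct words. *)
Lemma word_count_cvgy s :
  (forall p : nat, (0 < p)%N -> ~ forall n, s (n + p%:Z) = s n) ->
  word_count s n @[n --> \oo] --> \oo.
Proof.
move=> aper.
have sep (ij : nat * nat) : exists q : int,
    (ij.1 < ij.2)%N -> s (ij.1%:Z + q) != s (ij.2%:Z + q).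
  case: ij => i j /=; apply: contrapT => /forallNP h.
  have ij : (i < j)%N by apply: contrapT => nij; apply: (h 0) => /nij.
  apply: (aper (j - i)%N); first by rewrite subn_gt0.
  move=> n; have := h (n - i%:Z) => /not_implyP[_ /negP]; rewrite negbK => /eqP e.
  have -> : n = i%:Z + (n - i%:Z) by rewrite addrC subrK.
  by rewrite e; congr s; lia.
have [q qP] := choice sep.
move=> A [K _ KA].
(* All separating positions of the first K translates lie between -M and M, hence the word length 2
   * M + 1. *)
pose M := (\max_(i < K) \max_(j < K) `|q (i : nat, j : nat)|)%N.
exists M.*2.+1 => // n /= nM; apply: KA => /=.
pose h (i : 'I_K) := [ffun t : 'I_n => s (i%:Z - M%:Z + t%:Z)].
have key (i j : 'I_K) : (i < j)%N -> h i <> h j.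
  move=> ij hij; have /negP := qP (i : nat, j : nat) ij; apply => /=.
  set q0 := q _.
  have qM : (`|q0| <= M)%N.
    apply: leq_trans (leq_bigmax i).
    exact: (leq_bigmax (F := fun j : 'I_K => `|q (i : nat, j : nat)|%N) j).
  have tn : (`|(q0 + M%:Z)%R| < n)%N by lia.
  have := congr1 (fun w : {ffun 'I_n -> bool} => w (Ordinal tn)) hij.
  rewrite !ffunE /=.
  have -> : i%:Z - M%:Z + `|(q0 + M%:Z)%R|%N%:Z = i%:Z + q0 :> int by lia.
  have -> : j%:Z - M%:Z + `|(q0 + M%:Z)%R|%N%:Z = j%:Z + q0 :> int by lia.
  by move=> ->.
have hinj : injective h.
  move=> i j hij; apply/val_inj; case: (ltngtP i j) => //.
    by move=> /key/(_ hij).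
  by move=> /key/(_ (esym hij)).
rewrite -[leqLHS](card_ord K) -(card_codom hinj); apply: subset_leq_card.
apply/fintype.subsetP => _ /codomP[i ->]; rewrite unfold_in /=; apply/asboolP.
by exists (i%:Z - M%:Z).
Qed.

(** * Bowen balls and words *)

Section BowenCovering.
Context {R : realType} (s : biseq).

(** This monotonicity makes the limit in the topological slow entropy exist. *)
Lemma le_bowen_covering_number (e1 e2 : R) T : e1 <= e2 ->
  (bowen_covering_number (@subshift_map s) e2 T
   <= bowen_covering_number (@subshift_map s) e1 T)%E.
Proof.
move=> e12; apply: ereal_inf_le_tmp => _ [n [c cover] <-].
exists n => //; exists c; apply/seteqP; split=> // x _.
have [i _ ci] : (\bigcup_i bowen_ball (@subshift_map s) T (c i) e1) x by rewrite cover.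
by exists i => // t tT; apply: le_ball e12 _ (ci t tT).
Qed.

(** Every word starts some translate of [s], and the centre of a Bowen ball containing this
    translate shows the same word. So there are at least as many balls as words. *)
Lemma word_count_le_bowen (e : R) T : e <= 1 ->
  ((word_count s T)%:R%:E <= bowen_covering_number (@subshift_map s) e T)%E.
Proof.
move=> e1; apply: le_ereal_inf_tmp => _ [n [c cover] <-].
rewrite lee_fin ler_nat.
pose h (i : 'I_n) := [ffun t : 'I_T => val (c i) t%:Z].
rewrite -[leqRHS]card_ord; apply: leq_trans (leq_image_card h _).
apply: subset_leq_card; apply/fintype.subsetP => w; rewrite unfold_in /= => /asboolP[k ->].
have [i _ ci] : (\bigcup_i bowen_ball (@subshift_map s) T (c i) e) (orbit_point s k).
  by rewrite cover.
apply/codomP; exists i; apply/ffunP => t; rewrite !ffunE.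
(* A distance below 1 forces agreement at coordinate 0; applied at time t, it gives the t-th
   letter. *)
have /biseq_dist_ltP[[|m] ag lt_e] := ci t (ltnW (ltn_ord t)).
  by move: lt_e; rewrite expr0 ltNge e1.
have : val (iter t (@subshift_map s) (c i)) 0 =
    val (iter t (@subshift_map s) (orbit_point s k)) 0 := ag 0 (ltn0Sn m).
rewrite !val_iter_subshift_map add0r => ->.
by rewrite /= /shift_by addrC.
Qed.

End BowenCovering.

Theorem proposition4p12 (R : realType) (s : biseq)
    (mu : probability (g_sigma_algebraType (@open (subshift s))) R) :
  sturmian_sequence (R := R) s ->
  measure_preserving mu (@subshift_map s) ->
  exists a : R -> R -> R, [/\ scale_family a,
    metric_slow_entropy mu (@subshift_map s) a = 0%E &
    (0%E < topological_slow_entropy (@subshift_map s) a)%E].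
Proof.
move=> st pf; exists (power_scale (word_count s)).
have sf : scale_family (power_scale (R := R) (word_count s)).
  apply: power_scale_family; first exact: word_count_gt0.
  by apply: word_count_cvgy => p p0; exact: sturmian_aperiodic st p0.
split=> //.
- have lim0 k (P : 'I_k -> set _) : measurable_partition P ->
      lim (growth_exponent (power_scale (word_count s))
        (hamming_covering_number mu (@subshift_map s) P eps) @[eps --> 0^'+]) = 0%E.
    move=> partP; apply: lim_near_cst; first exact: ereal_hausdorff.
    near=> e.
    have [|N [T0 bound]] := hamming_covering_number_bounded (e := e) st pf partP.
      by near: e; exact: nbhs_right_gt.
    by apply: (growth_exponent_bounded (N := N)) => //; exists T0.
  apply/eqP; rewrite eq_le; apply/andP; split.
    by apply: ge_ereal_sup => _ [k [P [partP ->]]]; rewrite lim0.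
  (* The trivial partition keeps the supremum from being that of the empty set, which is -oo. *)
  have part1 : measurable_partition
      (fun _ : 'I_1 => [set: g_sigma_algebraType (@open (subshift s))]).
    split=> [//|i j _ _ _|]; first by rewrite (ord1 i) (ord1 j).
    by apply/seteqP; split=> // x _; exists ord0.
  by apply: ereal_sup_ubound; exists 1%N, (fun=> setT); split=> //; rewrite lim0.
- apply: (@lt_le_trans _ _ 1%E) => //; apply: lime_ge.
    apply: nonincreasing_at_right_is_cvge; near=> e => e1 e2 _ _ e12.
    by apply: le_growth_exponent => // T; exact: le_bowen_covering_number.
  (* At chi = 1 the scale is [word_count] itself, a lower bound for the Bowen covering numbers once
     e <= 1. *)
  near=> e; apply: growth_exponent_ge => //; near=> T.
  rewrite /power_scale powRr1// natrK; apply: word_count_le_bowen.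
  by near: e; apply: nbhs_right_le.
Unshelve. all: by end_near. Qed.
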